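(* Let $d\ge 1$ and let $\boldsymbol{X}=(X_1,\ldots,X_d)^{\prime}\sim N_d(\boldsymbol{\mu},\boldsymbol{\Sigma})$, where $\boldsymbol{\mu}=(\mu_1,\ldots,\mu_d)^{\prime}\in\mathbb{R}^d$ is unknown and $\boldsymbol{\Sigma}=((\sigma_{ij}))$ is a known (arbitrary) positive definite covariance matrix. Consider testing $H_i:\mu_i=0$ against $\mu_i\neq 0$ simultaneously for $i=1,\ldots,d$. Let $Z_i=X_i/\sqrt{\sigma_{ii}}$, let $P_i=\bar{\Psi}_1(Z_i^2)$ be the two-sided $z$-test $p$-values, let $w_i=1-R_i^2$, where $R_i^2$ is the squared multiple correlation between $Z_i$ and $(Z_1,\ldots,Z_d)\setminus\{Z_i\}$, and let $$\tilde{P}_i=\bar{\Psi}_1\left(w_i^{-1}\,\bar{\Psi}_1^{-1}(P_i)\right),\qquad i=1,\ldots,d.$$ Let $\alpha\in(0,1)$ and let $\alpha_1\in(0,1)$ satisfy $$\sum_{i=1}^d\bar{\Psi}_1\left(w_i\,\bar{\Psi}_1^{-1}(\alpha_1)\right)=\alpha.$$ Then, for every $\boldsymbol{\mu}\in\mathbb{R}^d$, the false discovery rate of the BH (stepup) method applied to $\tilde{P}_1,\ldots,\tilde{P}_d$ with critical constants $i\alpha_1$, $i=1,\ldots,d$, is controlled at $\alpha$, i.e. $\mathrm{FDR}\le\alpha$.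
   Context: $\bar{\Psi}_n=1-\Psi_n$, where $\Psi_n$ is the cdf of the central chi-squared distribution with $n$ degrees of freedom, and $\bar{\Psi}_n^{-1}$ is the inverse of $\bar{\Psi}_n$ on $(0,\infty)$. Squared multiple correlation: $R_i^2=\boldsymbol{\sigma}_{-i,i}^{\prime}\boldsymbol{\Sigma}_{-i,-i}^{-1}\boldsymbol{\sigma}_{-i,i}/\sigma_{ii}$, where $\boldsymbol{\Sigma}_{-i,-i}$ is $\boldsymbol{\Sigma}$ with its $i$th row and column removed and $\boldsymbol{\sigma}_{-i,i}$ is the $i$th column of $\boldsymbol{\Sigma}$ with its $i$th entry removed ($R_i^2=0$ if $d=1$). BH (stepup) method applied to statistics $\tilde{P}_1,\ldots,\tilde{P}_d$ with critical constants $\alpha_i=i\alpha_1$: with ordered values $\tilde{P}_{(1)}\le\cdots\le\tilde{P}_{(d)}$, let $R=\max\{1\le i\le d:\tilde{P}_{(i)}\le\alpha_i\}$; reject $H_i$ for every $i$ with $\tilde{P}_i\le\tilde{P}_{(R)}$ if the maximum exists, and reject no hypothesis otherwise (then $R=0$). False discovery rate: $\mathrm{FDR}=\mathbb{E}\left[\frac{V}{\max(R,1)}\right]$, where $R$ is the number of rejected null hypotheses and $V$ is the number of rejected null hypotheses $H_i$ that are true (i.e. with $\mu_i=0$). *)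

(* Defs.v *)
From HB Require Import structures.
From mathcomp Require Import all_boot all_order all_algebra.
From mathcomp Require Import all_classical all_reals all_analysis.

Set Implicit Arguments.
Unset Strict Implicit.
Unset Printing Implicit Defensive.
Import Order.TTheory GRing.Theory Num.Theory.
Import numFieldNormedType.Exports.
Local Open Scope classical_set_scope.
Local Open Scope ring_scope.

Section tuple_product_measure.
Context {R : realType} {disp : measure_display} {T : measurableType disp}.

Definition tuple_cons n (z : T * n.-tuple T) : n.+1.-tuple T :=
  [tuple of z.1 :: z.2].

Lemma measurable_tuple_cons n : measurable_fun setT (@tuple_cons n).
Proof. exact: measurable_cons. Qed.

HB.instance Definition _ n :=
  isMeasurableFun.Build _ _ _ _ (@tuple_cons n) (@measurable_tuple_cons n).

Section step.
Variables (m : {sigma_finite_measure set T -> \bar R}) (n : nat).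
Variable mn : {sigma_finite_measure set (n.-tuple T) -> \bar R}.

Definition tuple_prod_step : set (n.+1.-tuple T) -> \bar R :=
  pushforward (m \x mn)%E (@tuple_cons n).

Let tuple_prod_step0 : tuple_prod_step set0 = 0%E.
Proof. exact: measure0. Qed.

Let tuple_prod_step_ge0 A : (0 <= tuple_prod_step A)%E.
Proof. exact: measure_ge0. Qed.

Let tuple_prod_step_sigma_additive : semi_sigma_additive tuple_prod_step.
Proof. exact: measure_semi_sigma_additive. Qed.

HB.instance Definition _ := isMeasure.Build _ _ _ tuple_prod_step
  tuple_prod_step0 tuple_prod_step_ge0 tuple_prod_step_sigma_additive.

Let tuple_prod_step_sigma_finite : sigma_finite setT tuple_prod_step.
Proof.
have /sigma_finiteP[F [TF ndF Foo]] := sigma_finiteT m.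
have /sigma_finiteP[G [TG ndG Goo]] := sigma_finiteT mn.
pose u (t : n.+1.-tuple T) := (thead t, [tuple of behead t]).
have mu : measurable_fun setT u.
  apply/measurable_fun_pair => /=.
  - exact: measurable_tnth.
  - exact: measurable_behead.
have consK z : u (tuple_cons z) = z.
  by case: z => a b; rewrite /u /tuple_cons theadE; congr pair; apply/val_inj.
exists (fun k => u @^-1` (F k `*` G k)).
  rewrite -preimage_bigcup; apply/esym/seteqP; split=> // t _ /=.
  have [k _ Fk] : (\bigcup_n F n) (u t).1 by rewrite -TF.
  have [l _ Gl] : (\bigcup_n G n) (u t).2 by rewrite -TG.
  exists (maxn k l) => //; split.
  - by apply: (subsetPset _ _ (ndF _ _ (leq_maxl k l))).
  - by apply: (subsetPset _ _ (ndG _ _ (leq_maxr k l))).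
move=> k; have [mF Fk] := Foo k; have [mG Gk] := Goo k; split.
  by rewrite -[_ @^-1` _]setTI; apply: mu => //; exact: measurableX.
rewrite /tuple_prod_step /pushforward.
have -> : @tuple_cons n @^-1` (u @^-1` (F k `*` G k)) = F k `*` G k.
  by apply/seteqP; split=> z; rewrite /preimage /mkset consK.
by rewrite product_measure1E// lte_mul_pinfty// ge0_fin_numE.
Qed.

HB.instance Definition _ := @Measure_isSigmaFinite.Build _ _ _
  tuple_prod_step tuple_prod_step_sigma_finite.

End step.

(* The n-fold product measure m \x ... \x m; for n = 0 it is the Dirac mass on
   the empty tuple. *)
Fixpoint tuple_prod (m : {sigma_finite_measure set T -> \bar R}) (n : nat) :
    {sigma_finite_measure set (n.-tuple T) -> \bar R} :=
  match n with
  | 0 => \d_([tuple])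
  | k.+1 => tuple_prod_step m (tuple_prod m k)
  end.

End tuple_product_measure.

Section chi_squared.
Context {R : realType}.

(* The law of the sum of the squares of n independent N(0, 1) variables. *)
Definition chi2_cdf (n : nat) (x : R) : R :=
  fine (tuple_prod (normal_prob (0 : R) 1) n
    [set z | \sum_(i < n) tnth z i ^+ 2 <= x]).

Definition chi2_sf (n : nat) (x : R) : R := 1 - chi2_cdf n x.

(* The inverse of the restriction of chi2_sf n to ]0, +oo[.
   Outside the image of ]0, +oo[ under chi2_sf n, i.e. outside ]0, 1[ when
   0 < n, the value is 0. *)
Definition chi2_isf (n : nat) : R -> R :=
  'pinv_(fun=> 0) `]0, +oo[ (chi2_sf n).

End chi_squared.

Section multivariate_normal.
Context {R : realType} {d : nat}.
Implicit Types (mu : 'cV[R]_d) (Sigma : 'M[R]_d).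

Definition posdefmx Sigma :=
  Sigma^T = Sigma /\
  forall v : 'cV[R]_d, v != 0 -> 0 < (v^T *m Sigma *m v) 0 0.

Definition mvnormal_pdf mu Sigma (t : d.-tuple (measurableTypeR R)) : R :=
  let v := (\col_i tnth t i) - mu in
  (Num.sqrt ((pi *+ 2) ^+ d * \det Sigma))^-1 *
  expR (- (v^T *m invmx Sigma *m v) 0 0 / 2).

Definition is_mvnormal disp (T : measurableType disp) (P : probability T R)
    (X : {RV P >-> d.-tuple (measurableTypeR R)}) mu Sigma :=
  forall B : set (d.-tuple (measurableTypeR R)), measurable B ->
    distribution P X B =
    (\int[tuple_prod (@lebesgue_measure R) d]_(t in B)
       (mvnormal_pdf mu Sigma t)%:E)%E.

Definition sq_mult_corr Sigma (i : 'I_d) : R :=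
  let s := row' i (col i Sigma) in
  (s^T *m invmx (row' i (col' i Sigma)) *m s) 0 0 / Sigma i i.

End multivariate_normal.

Section multiple_testing.
Context {R : realType} {d : nat}.

(* The k-th smallest of p_1, ..., p_d, for 1 <= k <= d. *)
Definition order_stat (p : 'I_d -> R) (k : nat) : R :=
  nth 0 (sort <=%R (codom p)) k.-1.

Definition stepup_index (c : nat -> R) (p : 'I_d -> R) : nat :=
  \max_(k < d | order_stat p k.+1 <= c k.+1) k.+1.

Definition stepup_rejections (c : nat -> R) (p : 'I_d -> R) : {set 'I_d} :=
  let k := stepup_index c p in
  [set i | (0 < k)%N && (p i <= order_stat p k)].

Definition FDR disp (T : measurableType disp) (P : probability T R)
    (nulls : {set 'I_d}) (rejections : T -> {set 'I_d}) : \bar R :=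
  ('E_P[fun w => (#|rejections w :&: nulls|%:R /
                  (maxn #|rejections w| 1)%:R)%R])%E.

Definition true_nulls (mu : 'cV[R]_d) : {set 'I_d} := [set i | mu i 0 == 0].

Definition zstat (Sigma : 'M[R]_d) (x : d.-tuple (measurableTypeR R))
    (i : 'I_d) : R :=
  tnth x i / Num.sqrt (Sigma i i).

Definition pvalue (Sigma : 'M[R]_d) (x : d.-tuple (measurableTypeR R))
    (i : 'I_d) : R :=
  chi2_sf 1 (zstat Sigma x i ^+ 2).

Definition shift_weight (Sigma : 'M[R]_d) (i : 'I_d) : R :=
  1 - sq_mult_corr Sigma i.

Definition shifted_pvalue (Sigma : 'M[R]_d) (x : d.-tuple (measurableTypeR R))
    (i : 'I_d) : R :=
  chi2_sf 1 ((shift_weight Sigma i)^-1 * chi2_isf 1 (pvalue Sigma x i)).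

End multiple_testing.

(* Main.v *)
(**
Let A be the inverse of Sigma and q_i = A_ii.  Since 1 - R_i^2 =
1 / (q_i sigma_ii), the shifted p-value of coordinate i is
chi2_sf 1 (q_i X_i^2), and q_i is the conditional precision of X_i given the
other coordinates.

Let r_i be the largest k <= d such that at least k - 1 of the other shifted
p-values are at most k alpha_1; it does not depend on X_i.  If i is rejected,
the number of rejections is at least r_i, and the i-th shifted p-value is at most
r_i alpha_1.  Hence FDR is at most the sum over the true nulls i and over k of
P(q_i X_i^2 has p-value <= k alpha_1, r_i = k) / k.

Given the other coordinates, sqrt(q_i) X_i is N(m, 1) for some m depending on
them.  After symmetrisation the likelihood ratio of N(m, 1) to N(0, 1) is
increasing in |y| (it is proportional to cosh (m y)), so enlarging the rejection
region {y^2 >= c}, of null probability alpha_1, to one of null probability at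
most k alpha_1 multiplies its N(m, 1)-probability by at most k.  The k-th term
is therefore at most P(q_i X_i^2 >= c, r_i = k); these events are disjoint for
distinct k, and P(q_i X_i^2 >= c) = chi2_sf 1 (w_i c) since X_i is
N(0, sigma_ii).
*)

Require Import Defs.
From HB Require Import structures.
From mathcomp Require Import all_boot all_order all_algebra.
From mathcomp Require Import all_classical all_reals all_analysis.
From mathcomp Require Import measurable_realfun ring lra.

Set Implicit Arguments.
Unset Strict Implicit.
Unset Printing Implicit Defensive.
Import Order.TTheory GRing.Theory Num.Theory.
Import numFieldNormedType.Exports.
Local Open Scope classical_set_scope.
Local Open Scope ring_scope.

(** * Step-up procedures *)

Section stepup.
Context {R : realType} {d : nat}.
Implicit Types (p : 'I_d -> R) (c : nat -> R).

(** In a sorted sequence the entries at most [a] form an initial segment, so comparing an order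
    statistic with [a] amounts to counting. Step-up is handled below through these cardinalities. *)
Lemma order_stat_le p k a : (k < d)%N ->
  (order_stat p k.+1 <= a) = (k < #|[set j | (p j <= a)%R]%SET|)%N.
Proof.
move=> kd; rewrite /order_stat/=; set s := sort _ _.
have ss : sorted <=%R s by apply: sort_sorted; exact: le_total.
have sz : size s = d by rewrite size_sort size_codom card_ord.
have <- : count (<= a) s = #|[set j | (p j <= a)%R]%SET|.
  have /permP -> : perm_eq s (codom p) by rewrite perm_sort.
  rewrite codomE count_map -sum1_count -sum1_card big_enum_cond.
  by apply: eq_bigl => j; rewrite /= inE.
apply/idP/idP => [|/(nth_count_le 0 ss)//]; apply: contraLR.
by rewrite -leqNgt -ltNge => ck; apply: nth_count_gt => //; rewrite ck sz.
Qed.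

Lemma bigmax_succP (P : pred 'I_d) : (0 < \max_(k < d | P k) k.+1)%N ->
  exists2 k : 'I_d, P k & \max_(k < d | P k) k.+1 = k.+1.
Proof.
case: (pickP P) => [k0 Pk0 _|P0]; last by rewrite big_pred0.
by rewrite (bigop.bigmax_eq_arg k0)//; case: arg_maxnP => // k Pk _; exists k.
Qed.

(** This is r_i of the overview: coordinate [i] is counted as if its p-value met every threshold, so
    [p i] itself does not enter. *)
Definition loo_index c p i : nat :=
  \max_(k < d | (k < #|[set j | (j == i) || (p j <= c k.+1)%R]%SET|)%N) k.+1.

Lemma loo_index_le c p i : (loo_index c p i <= d)%N.
Proof. by apply/bigmax_leqP => k _. Qed.

Lemma eq_loo_index c p p' i : (forall j, j != i -> p j = p' j) ->
  loo_index c p i = loo_index c p' i.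
Proof.
move=> pp'; apply: eq_bigl => k; congr (_ < _)%N; apply: eq_card => j.
by rewrite !inE; case: eqVneq => //= /pp' ->.
Qed.

(** Counting [i] unconditionally only raises the counts, so the step-up index is at most
    [loo_index]. A rejected [i] then meets the threshold at [loo_index], where the count is
    therefore the true one, and that index is admissible for step-up too. *)
Lemma stepup_rejections_loo c p i :
  {homo c : k l / (k <= l)%N >-> k <= l} ->
  i \in stepup_rejections c p ->
  p i <= c (loo_index c p i) /\
  (0 < loo_index c p i <= #|stepup_rejections c p|)%N.
Proof.
move=> c_nd; rewrite inE => /andP[R0 pi]; set S := stepup_rejections c p.
have [r pr Rr] := bigmax_succP R0; rewrite -/(stepup_index c p) in Rr.
have RS : (r.+1 <= #|S|)%N.
  have -> : S = [set j | p j <= order_stat p r.+1]%SET.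
    by apply/setP => j; rewrite !inE R0 Rr.
  by rewrite -order_stat_le.
rewrite Rr in pi.
have rloo : (r.+1 <= loo_index c p i)%N.
  apply: (@leq_bigmax_cond _ _ (fun k : 'I_d => k.+1)).
  rewrite order_stat_le// in pr; apply: (leq_trans pr).
  apply/subset_leq_card/fintype.subsetP => j.
  by rewrite !inE => ->; rewrite orbT.
have loo0 : (0 < loo_index c p i)%N by exact: leq_trans rloo.
have [l pl lool] := bigmax_succP loo0; rewrite -/(loo_index c p i) in lool.
have pil : p i <= c (loo_index c p i).
  by rewrite (le_trans pi)// (le_trans pr)// c_nd.
split; rewrite // loo0 (leq_trans _ RS)// -Rr lool.
apply: (@leq_bigmax_cond _ _ (fun k : 'I_d => k.+1)).
rewrite order_stat_le// (leq_trans pl)//.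
apply/subset_leq_card/fintype.subsetP => j; rewrite !inE => /orP[/eqP ->|//].
by rewrite -lool.
Qed.

End stepup.

(** * Product measures and changes of variables *)

Section tuple_insertion.
Context {R : realType} {disp : measure_display} {T : measurableType disp}.

Definition tuple_ins n (i : 'I_n.+1) (x : T) (t : n.-tuple T) : n.+1.-tuple T :=
  [tuple if unlift i j is Some k then tnth t k else x | j < n.+1].

Lemma tnth_ins n (i : 'I_n.+1) x t : tnth (tuple_ins i x t) i = x.
Proof. by rewrite tnth_mktuple unlift_none. Qed.

Lemma tnth_ins_lift n (i : 'I_n.+1) x t k :
  tnth (tuple_ins i x t) (lift i k) = tnth t k.
Proof. by rewrite tnth_mktuple liftK. Qed.

Lemma tuple_ins0 n x (t : n.-tuple T) : tuple_ins ord0 x t = tuple_cons (x, t).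
Proof.
apply: eq_from_tnth => j; case: (unliftP ord0 j) => [k|] ->.
  by rewrite tnth_ins_lift tnthS.
by rewrite tnth_ins.
Qed.

(** Prepending an entry commutes with inserting behind it; this drives the induction for
    [ge0_integral_tuple_ins]. *)
Lemma tuple_insS n (j : 'I_n.+1) x y (t : n.-tuple T) :
  tuple_ins (lift ord0 j) x (tuple_cons (y, t)) =
  tuple_cons (y, tuple_ins j x t).
Proof.
apply: eq_from_tnth => k; case: (unliftP ord0 k) => [l|] ->; last first.
  have -> : ord0 = lift (lift ord0 j) ord0 :> 'I_n.+2 by apply/val_inj.
  by rewrite tnth_ins_lift.
rewrite tnthS/=; case: (unliftP j l) => [h|] ->; last by rewrite !tnth_ins.
have -> : lift ord0 (lift j h) = lift (lift ord0 j) (lift ord0 h).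
  by apply/val_inj => /=; rewrite /bump !leq0n !add1n ltnS addnS.
by rewrite !tnth_ins_lift tnthS.
Qed.

Lemma measurable_tuple_ins n (i : 'I_n.+1) :
  measurable_fun setT (fun z : n.-tuple T * T => tuple_ins i z.2 z.1).
Proof.
apply/measurable_fun_tnthP => j; case: (unliftP i j) => [k|] ->.
  rewrite [X in measurable_fun _ X](_ : _ = (tnth (T:=T) ^~ k) \o fst).
    exact: measurableT_comp (@measurable_tnth _ _ _ k) measurable_fst.
  by apply/funext => z /=; rewrite tnth_ins_lift.
rewrite [X in measurable_fun _ X](_ : _ = snd)//.
by apply/funext => z /=; rewrite tnth_ins.
Qed.

Variable m : {sigma_finite_measure set T -> \bar R}.

Lemma ge0_integral_tuple_cons n (f : n.+1.-tuple T -> \bar R) :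
  measurable_fun setT f -> (forall t, 0 <= f t)%E ->
  (\int[tuple_prod m n.+1]_t f t =
   \int[m \x tuple_prod m n]_z f (tuple_cons z))%E.
Proof.
move=> mf f0.
rewrite /= /tuple_prod_step ge0_integral_pushforward ?preimage_setT//.
Qed.

(** [tuple_prod] peels off coordinate 0, so Tonelli settles [ord0]; for a later position the
    induction hypothesis is applied with coordinate 0 frozen. *)
Lemma ge0_integral_tuple_ins n (i : 'I_n.+1) (f : n.+1.-tuple T -> \bar R) :
  measurable_fun setT f -> (forall t, 0 <= f t)%E ->
  (\int[tuple_prod m n.+1]_t f t =
   \int[tuple_prod m n]_t \int[m]_x f (tuple_ins i x t))%E.
Proof.
elim: n i f => [|n IHn] i f mf f0; case: (unliftP ord0 i) => [j|] ->.
- by case: j.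
- rewrite ge0_integral_tuple_cons// fubini_tonelli2//; last first.
    exact: measurableT_comp mf (@measurable_tuple_cons _ _ _).
  by apply: eq_integral => t _; apply: eq_integral => x _; rewrite tuple_ins0.
- have mfi : measurable_fun setT (fun z => f (tuple_ins (lift ord0 j) z.2 z.1)).
    exact: measurableT_comp mf (measurable_tuple_ins _).
  rewrite ge0_integral_tuple_cons// fubini_tonelli1//; last first.
    exact: measurableT_comp mf (@measurable_tuple_cons _ _ _).
  have mF := measurable_fun_fubini_tonelli_F _ mfi (fun=> f0 _) :
    measurable_fun _ (fubini_F m _).
  rewrite [RHS]ge0_integral_tuple_cons//; last first.
    by move=> t; exact: integral_ge0.
  rewrite fubini_tonelli1//; last 2 first.
  - exact: (measurableT_comp mF (@measurable_tuple_cons _ _ _)).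
  - by move=> t; exact: integral_ge0.
  apply: eq_integral => y _; rewrite /fubini_F (IHn j)//; last first.
    by apply: (measurableT_comp mf); apply: measurable_cons => //;
      exact: measurable_id.
  apply: eq_integral => t _; apply: eq_integral => x _.
  by rewrite tuple_insS.
- rewrite ge0_integral_tuple_cons// fubini_tonelli2//; last first.
    exact: measurableT_comp mf (@measurable_tuple_cons _ _ _).
  by apply: eq_integral => t _; apply: eq_integral => x _; rewrite tuple_ins0.
Qed.

End tuple_insertion.

(** * Affine substitutions and translation invariance *)

Section affine.
Context {R : realType}.
Local Notation leb := (@lebesgue_measure R).

(** [|a|] times the image of Lebesgue measure under [a * x + b] agrees with Lebesgue measure on
    half-open intervals, hence everywhere. *)
Lemma ge0_integral_affine (a b : R) (f : R -> \bar R) : a != 0 ->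
  measurable_fun setT f -> (forall x, 0 <= f x)%E ->
  (\int[leb]_x f x = `|a|%:E * \int[leb]_x f (a * x + b)%R)%E.
Proof.
move=> a0 mf f0; have ra0 : 0 < `|a| by rewrite normr_gt0.
pose g (x : R) : R := a * x + b.
have mg : @measurable_fun _ _ (measurableTypeR R) (measurableTypeR R) setT g.
  by apply: measurable_funD => //; exact: measurable_funM.
pose gm : {mfun (measurableTypeR R) >-> (measurableTypeR R)} :=
  HB.pack g (isMeasurableFun.Build _ _ _ _ _ mg).
pose nu_of : {measure set (measurableTypeR R) -> \bar R} :=
  mscale (NngNum (ltW ra0)) (pushforward leb gm).
pose nu := nu_of mg.
have nuE A : measurable A -> leb A = nu A.
  apply: lebesgue_measure_unique => _ [[u v] /= _ <-].
  rewrite /nu /mscale/= /pushforward.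
  have [a_gt0|a_lt0|a_eq0] := ltgtP 0 a; last by rewrite -a_eq0 eqxx in a0.
  - have -> : g @^-1` `]u, v] = `](u - b) / a, (v - b) / a]%classic.
      apply/seteqP; split => x; rewrite /preimage /= !in_itv/= /g;
        by rewrite ltr_pdivrMr// ler_pdivlMr// ltrBlDr lerBrDr [x * a]mulrC.
    rewrite !lebesgue_measure_itv/= !lte_fin ltr_pM2r ?invr_gt0// ltrD2r.
    case: ifP => _; last by rewrite mule0.
    rewrite -!EFinB -EFinM gtr0_norm//; congr EFin; field.
    by rewrite gt_eqF.
  (* A negative slope swaps the open and the closed end, which does not affect the length. *)
  - have -> : g @^-1` `]u, v] = `[(v - b) / a, (u - b) / a[%classic.
      apply/seteqP; split => x; rewrite /preimage /= !in_itv/= /g andbC;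
        by rewrite ler_ndivrMr// ltr_ndivlMr// ltrBlDr lerBrDr [x * a]mulrC.
    rewrite !lebesgue_measure_itv/= !lte_fin ltr_nM2r ?invr_lt0// ltrD2r.
    case: ifP => _; last by rewrite mule0.
    rewrite -!EFinB -EFinM ltr0_norm//; congr EFin; field.
    by rewrite lt_eqF.
rewrite (eq_measure_integral nu); last by move=> A mA _; exact: nuE.
rewrite ge0_integral_mscale//= ge0_integral_pushforward ?preimage_setT//.
Qed.

Definition tuple_shift n (b : 'I_n -> R) (t : n.-tuple (measurableTypeR R)) :
    n.-tuple (measurableTypeR R) :=
  [tuple tnth t j + b j | j < n].

Lemma measurable_tuple_shift n (b : 'I_n -> R) :
  measurable_fun setT (tuple_shift b).
Proof.
apply/measurable_fun_tnthP => j.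
rewrite [X in measurable_fun _ X](_ : _ = fun t => tnth t j + b j).
  by apply: measurable_funD => //; exact: measurable_tnth.
by apply/funext => z /=; rewrite tnth_mktuple.
Qed.

(** Induction on the coordinates, each step being the affine substitution with slope 1. *)
Lemma ge0_integral_tuple_shift n (b : 'I_n -> R)
    (f : n.-tuple (measurableTypeR R) -> \bar R) :
  measurable_fun setT f -> (forall t, 0 <= f t)%E ->
  (\int[tuple_prod leb n]_t f (tuple_shift b t) =
   \int[tuple_prod leb n]_t f t)%E.
Proof.
elim: n b f => [|n IHn] b f mf f0.
  by apply: eq_integral => t _; congr f; apply: eq_from_tnth; case.
have mfc : measurable_fun setT (fun z => f (tuple_cons z)).
  exact: measurableT_comp mf (@measurable_tuple_cons _ _ _).
rewrite ge0_integral_tuple_cons//; last first.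
  exact: measurableT_comp mf (measurable_tuple_shift b).
rewrite [RHS]ge0_integral_tuple_cons//.
rewrite !fubini_tonelli1//; last first.
  apply: (measurableT_comp mf);
    apply: (measurableT_comp (measurable_tuple_shift b)).
  exact: measurable_tuple_cons.
rewrite [RHS](ge0_integral_affine (b ord0) (@oner_neq0 _))//; last 2 first.
- exact: measurable_fun_fubini_tonelli_F.
- by move=> x; exact: integral_ge0.
rewrite normr1 mul1e; apply: eq_integral => y _.
rewrite /fubini_F -[RHS](IHn (fun k => b (lift ord0 k)))//; last first.
  by apply: (measurableT_comp mf); apply: measurable_cons => //;
    exact: measurable_id.
apply: eq_integral => t _; congr f; apply: eq_from_tnth => j.
rewrite tnth_mktuple; case: (unliftP ord0 j) => [k|] ->.
  by rewrite !tnthS tnth_mktuple.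
by rewrite mul1r.
Qed.

End affine.

(** * The chi-squared distribution with one degree of freedom *)

Lemma pinv_dflt {T U : Type} (dflt : U -> T) (A : set T) (f : T -> U) (y : U) :
  ~ (f @` A) y -> 'pinv_dflt A f y = dflt y.
Proof. by move=> fAy; rewrite /pinv_ splitV; cbn; case: pselect => // /fAy. Qed.

Section standard_normal.
Context {R : realType}.
Local Notation leb := (@lebesgue_measure R).
Local Notation N := (normal_prob (0 : R) 1).
Local Notation phi := (normal_pdf (0 : R) 1).
Local Notation sf := (@chi2_sf R 1).

Lemma measurable_sqr : measurable_fun setT (fun y : R => y ^+ 2).
Proof. exact: measurable_funX. Qed.

Lemma measurable_preimage_sqr (A : set R) : measurable A ->
  measurable [set y : R | A (y ^+ 2)].
Proof.
by move=> mA; rewrite -[X in measurable X]setTI; exact: measurable_sqr.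
Qed.

Lemma measurable_sqr_gt (x : R) : measurable [set y : R | x < y ^+ 2].
Proof.
have := measurable_preimage_sqr (measurable_itv `]x, +oo[).
by congr measurable; apply/seteqP; split => y /=; rewrite in_itv/= andbT.
Qed.

Lemma measurable_sqr_ge (x : R) : measurable [set y : R | x <= y ^+ 2].
Proof.
have := measurable_preimage_sqr (measurable_itv `[x, +oo[).
by congr measurable; apply/seteqP; split => y /=; rewrite in_itv/= andbT.
Qed.

Lemma normal_prob_fin_num (A : set R) : measurable A -> N A \is a fin_num.
Proof. by move=> mA; exact: fin_num_measure. Qed.

Lemma chi2_sf1E (x : R) : (sf x)%:E = N [set y | x < y ^+ 2].
Proof.
have mA : measurable [set y : R | y ^+ 2 <= x].
  have := measurable_preimage_sqr (measurable_itv `]-oo, x]).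
  by congr measurable; apply/seteqP; split => y /=; rewrite in_itv.
rewrite /chi2_sf /chi2_cdf /= /tuple_prod_step /pushforward.
(* The one-fold product is the image of [N] times a Dirac mass, and the event pulls back to a
   rectangle whose second side has mass 1. *)
have -> : @tuple_cons _ _ 0 @^-1`
    [set z : 1.-tuple _ | \sum_(i < 1) tnth z i ^+ 2 <= x]
    = [set y : R | y ^+ 2 <= x] `*` setT.
  apply/seteqP; split => -[y t];
    rewrite /preimage/= big_ord_recl big_ord0 addr0;
    by [|case].
rewrite product_measure1E// [X in (_ * X)%E](_ : _ = 1%E) ?mule1;
  last exact: diracT.
rewrite EFinB fineK ?normal_prob_fin_num//.
transitivity (N (~` [set y | y ^+ 2 <= x])); last congr (N _).
  rewrite probability_setC//.
by apply/seteqP; split => y /=; rewrite ltNge => /negP.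
Qed.

Lemma chi2_sf1_ge0 x : 0 <= sf x.
Proof. by rewrite -lee_fin chi2_sf1E. Qed.

Lemma chi2_sf1_le x y : x <= y -> sf y <= sf x.
Proof.
move=> xy; rewrite -lee_fin !chi2_sf1E le_measure ?inE//;
  try exact: measurable_sqr_gt.
by move=> z /=; exact: le_lt_trans.
Qed.

(** The boundary [y ^+ 2 = x] has at most two points and [N] has a density, so weak and strict
    inequalities give the same mass. *)
Lemma normal_prob_sqr_ge x : N [set y | x <= y ^+ 2] = (sf x)%:E.
Proof.
rewrite chi2_sf1E.
have -> : [set y : R | x <= y ^+ 2] =
    [set y | x < y ^+ 2] `|` [set y | y ^+ 2 = x].
  apply/seteqP; split => y /=; rewrite le_eqVlt.
    by case/orP => [/eqP|]; [right|left].
  by case => [->|->]; rewrite ?eqxx ?orbT.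
have mE : measurable [set y : R | y ^+ 2 = x].
  by apply: (measurable_preimage_sqr (A := [set x])); exact: measurable_set1.
rewrite measureU0//; first exact: measurable_sqr_gt.
have /null_content_dominatesP := @normal_prob_dominates R 0 1; apply => //.
apply: countable_lebesgue_measure0.
apply: (@sub_countable _ _ _ [set Num.sqrt x; - Num.sqrt x]).
  apply: subset_card_le => y /= <-; rewrite sqrtr_sqr.
  by have [y0|y0] := leP 0 y; [left; rewrite ger0_norm|right;
    rewrite ltr0_norm ?opprK].
exact: finite_set_countable.
Qed.

Lemma chi2_sf1_0 : sf 0 = 1.
Proof.
apply: EFin_inj; rewrite -normal_prob_sqr_ge -(@probability_setT _ _ _ N).
by congr (N _); apply/seteqP; split => // y _ /=; exact: sqr_ge0.
Qed.

Lemma normal_pdf01E (y : R) : phi y = normal_peak (1 : R) * expR (- y ^+ 2 / 2).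
Proof.
by rewrite normal_pdfE ?oner_neq0// /normal_fun subr0 expr1n.
Qed.

(** The shell [x < z ^+ 2 <= y] contains an interval of positive length on which the density is at
    least its value at [Num.sqrt y], so it has positive mass. *)
Lemma chi2_sf1_lt x y : 0 <= x -> x < y -> sf y < sf x.
Proof.
move=> x0 xy; have y0 : 0 < y := le_lt_trans x0 xy.
rewrite -lte_fin !chi2_sf1E.
have -> : [set z : R | x < z ^+ 2] =
    [set z | y < z ^+ 2] `|` [set z | x < z ^+ 2 <= y].
  apply/seteqP; split => z /=.
    by move=> xz; have [zy|yz] := leP (z ^+ 2) y; [right; rewrite xz|left].
  by case=> [|/andP[]//]; exact: lt_trans.
have mB : measurable [set z : R | x < z ^+ 2 <= y].
  have -> : [set z : R | x < z ^+ 2 <= y] =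
      [set z : R | x < z ^+ 2] `&` ~` [set z | y < z ^+ 2].
    apply/seteqP; split => z /=; first by move=> /andP[-> zy]; split=> //;
      apply/negP; rewrite -leNgt.
    by move=> [-> /negP]; rewrite -leNgt.
  apply: measurableI; first exact: measurable_sqr_gt.
  by apply: measurableC; exact: measurable_sqr_gt.
rewrite measureU//; last 2 first.
- exact: measurable_sqr_gt.
- by apply/seteqP; split => // z /= [yz /andP[_]]; rewrite leNgt yz.
rewrite lteDl; last by apply: normal_prob_fin_num; exact: measurable_sqr_gt.
pose I : set R := `]Num.sqrt x, Num.sqrt y]%classic.
have IB : I `<=` [set z | x < z ^+ 2 <= y].
  move=> z; rewrite /I /= in_itv/= => /andP[xz zy].
  have z0 : 0 <= z by rewrite (le_trans (sqrtr_ge0 x))// ltW.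
  by rewrite -(sqr_sqrtr x0) -(sqr_sqrtr (ltW y0)) ltr_sqr ?ler_sqr ?nnegrE
    ?sqrtr_ge0// xz.
apply: (@lt_le_trans _ _ (N I)); last first.
  by apply: le_measure; rewrite ?inE//; exact: measurable_itv.
apply: (@lt_le_trans _ _ (\int[leb]_(z in I) (phi (Num.sqrt y))%:E)%E).
  rewrite integral_cst; last exact: measurable_itv.
  rewrite [X in (_ * X)%E]lebesgue_measure_itv/= lte_fin ltr_sqrt// xy.
  rewrite -EFinB -EFinM lte_fin mulr_gt0 ?subr_gt0 ?ltr_sqrt//.
  by rewrite normal_pdf01E mulr_gt0 ?expR_gt0 ?normal_peak_gt0 ?oner_neq0.
apply: ge0_le_integral => //.
- exact: measurable_itv.
- by move=> z _; rewrite lee_fin normal_pdf_ge0.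
- apply/measurable_EFinP; apply: measurable_funTS; exact: measurable_normal_pdf.
- move=> z /IB /= /andP[xz zy].
  rewrite lee_fin !normal_pdf01E ler_wpM2l ?normal_peak_ge0// ler_expR.
  by rewrite sqr_sqrtr ?(ltW y0)// !mulNr lerN2 ler_pM2r ?invr_gt0.
Qed.

Lemma chi2_sf1_inj : {in `]0, +oo[%classic &, injective sf}.
Proof.
move=> x y; rewrite !inE/= !in_itv/= !andbT => x0 y0 sfxy.
by have [xy|yx|//] := ltgtP x y;
  [have := chi2_sf1_lt (ltW x0) xy|have := chi2_sf1_lt (ltW y0) yx];
  rewrite sfxy ltxx.
Qed.

(** At [x = 0] the level [sf 0 = 1] is not attained on []0, +oo[], and the default value 0 is the
    right answer. This covers a vanishing test statistic. *)
Lemma chi2_isf1K x : 0 <= x -> chi2_isf 1 (sf x) = x.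
Proof.
rewrite le_eqVlt => /predU1P[<-|x0]; last first.
  by rewrite /chi2_isf pinvKV//;
    [exact: chi2_sf1_inj|rewrite inE/= in_itv/= x0].
rewrite /chi2_isf pinv_dflt//= => -[y /=]; rewrite in_itv/= andbT => y0 sfy.
by have := chi2_sf1_lt (lexx 0) y0; rewrite sfy ltxx.
Qed.

(* Outside the image of ]0, +oo[ the junk value of chi2_isf 1 is 0. *)
Lemma chi2_isf1P a : 0 < chi2_isf 1 a /\ sf (chi2_isf 1 a) = a \/ chi2_isf 1 a
  = 0.
Proof.
have [[x /=]|na] := pselect ((sf @` `]0, +oo[) a); last first.
  by right; rewrite /chi2_isf pinv_dflt.
rewrite in_itv/= andbT => x0 <-; left.
by rewrite chi2_isf1K// ltW.
Qed.

(** [sf] is nonincreasing, so its sublevel sets are intervals. *)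
Lemma measurable_chi2_sf1_le (a : R) : measurable [set x | sf x <= a].
Proof.
apply: is_interval_measurable => x y /= sfx sfy z /andP[xz zy].
exact: le_trans (chi2_sf1_le xz) sfx.
Qed.

Lemma measurable_chi2_sf1_sqr_le (a : R) : measurable [set y | sf (y ^+ 2) <=
  a].
Proof. exact: measurable_preimage_sqr (measurable_chi2_sf1_le a). Qed.

(** With [t] the infimum of the nonnegative points where [sf] is at most [a], the event lies in
    [t <= y ^+ 2]. Beyond [t], [sf] is at most [a], and the events [F n] increase to [t < y ^+ 2],
    so the bound passes to the limit. *)
Lemma chi2_sf1_superuniform (a : R) : 0 <= a ->
  (N [set y | (sf (y ^+ 2) <= a)%R] <= a%:E)%E.
Proof.
move=> a0; pose A := [set x | 0 <= x /\ sf x <= a].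
have [[x0 Ax0]|A0] := pselect (A !=set0); last first.
  rewrite (_ : [set y | _] = set0) ?measure0// -subset0 => y /= ya.
  by apply: A0; exists (y ^+ 2); split => //; exact: sqr_ge0.
have hA : has_inf A by split; [exists x0|exists 0 => x []].
set t := inf A.
apply: (@le_trans _ _ (N [set y | t <= y ^+ 2])).
  apply: le_measure; rewrite ?inE.
  - exact: measurable_chi2_sf1_sqr_le.
  - exact: measurable_sqr_ge.
  - by move=> y /= ya; apply: ge_inf => //; [exists 0 => x []|split => //;
    exact: sqr_ge0].
rewrite normal_prob_sqr_ge chi2_sf1E.
pose F n := [set y : R | t + n.+1%:R^-1 < y ^+ 2].
have -> : [set y : R | t < y ^+ 2] = \bigcup_n F n.
  apply/seteqP; split => y /=; last first.
    by move=> [n _] /=; apply: le_lt_trans; rewrite lerDl.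
  rewrite -subr_gt0 => /ltr_add_invr[n]; rewrite add0r => ny; exists n => //.
  by rewrite /F /= -ltrBrDl.
have mF n : measurable (F n) by exact: measurable_sqr_gt.
have cvgF : N (F n) @[n --> \oo] --> N (\bigcup_n F n).
  apply: nondecreasing_cvg_mu => //; first exact: bigcupT_measurable.
  move=> n m nm; apply/subsetPset => y; rewrite /F /=; apply: le_lt_trans.
  by rewrite lerD2l lef_pV2 ?posrE// ler_nat.
rewrite -(cvg_lim _ cvgF)//; apply: lime_le; first by apply/cvg_ex;
  exists (N (\bigcup_n F n)).
apply: nearW => n; rewrite -chi2_sf1E lee_fin.
have [x [_ xa] xt] : exists2 x, A x & x < t + n.+1%:R^-1.
  by apply: inf_adherent => //; rewrite invr_gt0 ltr0n.
exact: le_trans (chi2_sf1_le (ltW xt)) xa.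
Qed.

End standard_normal.

(** * Monotone likelihood ratio of the symmetrised normal density *)

Section likelihood_ratio.
Context {R : realType}.
Local Notation leb := (@lebesgue_measure R).
Local Notation N := (normal_prob (0 : R) 1).
Local Notation phi := (normal_pdf (0 : R) 1).

Lemma expRDN_le (u v : R) : `|u| <= `|v| ->
  expR u + expR (- u) <= expR v + expR (- v).
Proof.
have expRDN_norm (t : R) : expR t + expR (- t) = expR `|t| + expR (- `|t|).
  by have [t0|t0] := leP 0 t;
    [rewrite ger0_norm|rewrite ltr0_norm// opprK addrC].
rewrite (expRDN_norm u) (expRDN_norm v) !expRN => uv.
have a1 : 1 <= expR `|u| by rewrite -expR0 ler_expR.
have ab : expR `|u| <= expR `|v| by rewrite ler_expR.
move: (expR `|u|) (expR `|v|) a1 ab => a b a1 ab.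
have a0 : 0 < a by rewrite (lt_le_trans ltr01).
have b0 : 0 < b by rewrite (lt_le_trans a0).
(* The difference of [b + b^-1] and [a + a^-1] factors, and both factors are nonnegative since
   [1 <= a <= b]. *)
rewrite -subr_ge0 (_ : _ - _ = (b - a) * (1 - (a * b)^-1)); last first.
  by field; rewrite !gt_eqF.
rewrite mulr_ge0 ?subr_ge0// invf_le1 ?mulr_gt0//.
by rewrite -[1]mulr1 ler_pM// (le_trans a1).
Qed.

(** The sum of the N(m, 1) and N(-m, 1) densities divided by [phi]. *)
Let h (m y : R) := expR (- m ^+ 2 / 2) * (expR (m * y) + expR (- (m * y))).

Let h_le m y z : `|y| <= `|z| -> h m y <= h m z.
Proof.
move=> yz; rewrite ler_wpM2l ?expR_ge0// expRDN_le// !normrM.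
by rewrite ler_wpM2l.
Qed.

Let h_ge0 m y : 0 <= h m y.
Proof. by rewrite mulr_ge0 ?addr_ge0 ?expR_ge0. Qed.

Let normal_pdfDN m y : phi (y - m) + phi (y + m) = h m y * phi y.
Proof.
rewrite !normal_pdf01E -mulrDr [RHS]mulrCA; congr (_ * _).
by rewrite /h mulrAC mulrDr -!expRD; congr (expR _ + expR _); field.
Qed.

Lemma normal_pdf01N y : phi (- y) = phi y.
Proof. by rewrite !normal_pdf01E sqrrN. Qed.

Lemma measurable_normal_pdf_shift m :
  measurable_fun setT (fun y : R => (phi (y - m))%:E).
Proof.
apply/measurable_EFinP; apply: measurableT_comp;
  first exact: measurable_normal_pdf.
exact: measurable_funB.
Qed.

Lemma integral_normal_pdf_reflect (S : set R) m : measurable S ->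
  (forall y, S y -> S (- y)) ->
  (\int[leb]_(y in S) (phi (y - m))%:E = \int[leb]_(y in S) (phi (y + m))%:E)%E.
Proof.
move=> mS SN; rewrite integral_mkcond [RHS]integral_mkcond.
rewrite (ge0_integral_affine 0 (a := -1)) ?oppr_eq0 ?oner_eq0//; last 2 first.
- apply/(measurable_restrictT _ _).1 => //.
  exact: measurable_funTS (measurable_normal_pdf_shift m).
- by apply: erestrict_ge0 => y _; rewrite lee_fin normal_pdf_ge0.
rewrite normrN normr1 mul1e; apply: eq_integral => y _.
rewrite mulN1r addr0 /patch -opprD normal_pdf01N.
suff -> : (- y \in S) = (y \in S) by [].
by apply/idP/idP; rewrite !inE => /SN; rewrite ?opprK.
Qed.

(* The ratio of the symmetrised density of N(m, 1) to that of N(0, 1) is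
   proportional to cosh (m y), hence increasing in |y|. *)
Lemma normal_pdf_mlr (S : set R) (m c k : R) : measurable S ->
  (forall y, S y -> S (- y)) -> 0 <= c -> [set y | c <= y ^+ 2] `<=` S ->
  1 <= k -> (N S <= k%:E * N [set y | (c <= y ^+ 2)%R])%E ->
  (\int[leb]_(y in S) (phi (y - m))%:E <=
   k%:E * \int[leb]_(y in [set y | (c <= y ^+ 2)%R]) (phi (y - m))%:E)%E.
Proof.
move=> mS SN c0 AS k1; set A := [set y | _] in AS * => NSA.
have mA : measurable A by exact: measurable_sqr_ge.
have AN y : A y -> A (- y) by rewrite /A/= sqrrN.
have k0 : 0 <= k by rewrite (le_trans ler01).
pose g y := (h m y * phi y)%:E.
have g0 y : (0 <= g y)%E by rewrite lee_fin mulr_ge0 ?normal_pdf_ge0.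
have mg D : measurable_fun D g.
  apply: measurable_funTS.
  rewrite (_ : g = fun y => (phi (y - m))%:E + (phi (y - (- m)))%:E)%E.
    by apply: emeasurable_funD; exact: measurable_normal_pdf_shift.
  by apply/funext => y; rewrite opprK -EFinD normal_pdfDN.
(* On a symmetric set the shifts by [m] and by [- m] give equal mass, so a shifted density may be
   replaced by the symmetrised one. *)
have double (D : set R) : measurable D -> (forall y, D y -> D (- y)) ->
    (2%:E * \int[leb]_(y in D) (phi (y - m))%:E = \int[leb]_(y in D) g y)%E.
  move=> mD DN; rewrite mule_natl mule2n.
  rewrite [X in (_ + X)%E](integral_normal_pdf_reflect _ mD DN).
  rewrite -ge0_integralD//.
  - by apply: eq_integral => y _; rewrite -EFinD normal_pdfDN.
  - by move=> y _; rewrite lee_fin normal_pdf_ge0.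
  - exact: measurable_funTS (measurable_normal_pdf_shift m).
  - by move=> y _; rewrite lee_fin normal_pdf_ge0.
  - have := measurable_normal_pdf_shift (- m).
    rewrite opprK; exact: measurable_funTS.
suff gSA : (\int[leb]_(y in S) g y <= k%:E * \int[leb]_(y in A) g y)%E.
  rewrite -(@lee_pmul2l _ 2%:E)//.
  by rewrite muleCA !double.
(* The ratio on the boundary of [A]: it separates the values of [h] on [A] from those off [A]. *)
pose H := h m (Num.sqrt c).
have HA y : A y -> H <= h m y.
  by move=> Ay; apply: h_le;
    rewrite ger0_norm ?sqrtr_ge0// -(sqrtr_sqr y) ler_wsqrtr.
have HNA y : ~ A y -> h m y <= H.
  move=> /negP; rewrite -ltNge => Ay; apply: h_le.
  by rewrite [leRHS]ger0_norm ?sqrtr_ge0// -(sqrtr_sqr y) ler_wsqrtr// ltW.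
have mphi (D : set R) : measurable_fun D (EFin \o phi).
  by apply/measurable_EFinP/measurable_funTS; exact: measurable_normal_pdf.
have mHphi (D : set R) : measurable_fun D (fun y => (H * phi y)%:E).
  by apply/measurable_EFinP/measurable_funM => //; exact/measurable_EFinP.
have NE (D : set R) : measurable D ->
    (H%:E * N D = \int[leb]_(y in D) (H * phi y)%:E)%E.
  move=> mD; under [RHS]eq_integral do rewrite EFinM.
  rewrite ge0_integralZl//; last by rewrite lee_fin; exact: h_ge0.
    exact: mphi.
  by move=> y _; rewrite lee_fin normal_pdf_ge0.
have mSA : measurable (S `\` A) by exact: measurableD.
(* Cancelling the common part [A] leaves the integral over the rest of [S] to be bounded by [k - 1]
   times that over [A]; both are compared with [H] times the [N]-mass of the set. *)
rewrite -(setDUK AS) ge0_integral_setU//; last 2 first.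
- exact: mg.
- by rewrite disj_set2E setDIK.
have -> : (k%:E = 1 + (k - 1)%:E)%E by rewrite -EFinD addrC subrK.
rewrite ge0_muleDl ?lee_fin ?subr_ge0// mul1e leeD2l//.
apply: (@le_trans _ _ (H%:E * N (S `\` A))%E).
  rewrite NE//; apply: ge0_le_integral => //.
  - exact: mg.
  - exact: mHphi.
  by move=> y [_ /HNA hy]; rewrite lee_fin ler_wpM2r ?normal_pdf_ge0.
apply: (@le_trans _ _ ((k - 1)%:E * (H%:E * N A))%E); last first.
  rewrite lee_pmul//; rewrite ?lee_fin ?subr_ge0//.
    by rewrite mule_ge0// lee_fin h_ge0.
  rewrite NE//; apply: ge0_le_integral => //.
  - by move=> y _; rewrite lee_fin mulr_ge0 ?h_ge0 ?normal_pdf_ge0.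
  - exact: mHphi.
  - exact: mg.
  by move=> y /HA hy; rewrite lee_fin ler_wpM2r ?normal_pdf_ge0.
rewrite muleCA lee_pmul ?lee_fin ?h_ge0//.
rewrite measureD// ?setIidr//; last first.
  by rewrite ltey_eq normal_prob_fin_num.
rewrite [leLHS](_ : _ = N S - N A)%E//.
move: NSA; rewrite -(fineK (normal_prob_fin_num mS)) -(fineK
  (normal_prob_fin_num mA)).
by rewrite -EFinM -EFinB -EFinM !lee_fin mulrBl mul1r lerBlDr subrK.
Qed.

End likelihood_ratio.

(** * Rescaling to the standard normal law *)

Section scaling.
Context {R : realType}.
Local Notation leb := (@lebesgue_measure R).
Local Notation N := (normal_prob (0 : R) 1).
Local Notation phi := (normal_pdf (0 : R) 1).

Lemma measurable_scale (a : R) (B : set R) : measurable B ->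
  measurable [set x | B (a * x)].
Proof.
have mf : measurable_fun setT (fun x : R => a * x) by exact: measurable_funM.
by move=> mB; rewrite -[X in measurable X]setTI; exact: mf.
Qed.

Lemma ge0_integral_scale (a : R) (B : set R) (f : R -> \bar R) : a != 0 ->
  measurable B -> measurable_fun setT f -> (forall x, 0 <= f x)%E ->
  (\int[leb]_(x in B) f x =
   `|a|%:E * \int[leb]_(x in [set x | B (a * x)%R]) f (a * x)%R)%E.
Proof.
move=> a0 mB mf f0; rewrite integral_mkcond [in RHS]integral_mkcond.
rewrite (ge0_integral_affine 0 a0); last 2 first.
- by apply/(measurable_restrictT _ _).1 => //; exact: measurable_funTS.
- by apply: erestrict_ge0.
congr (_ * _)%E; apply: eq_integral => x _; rewrite addr0 /patch.
suff -> : (a * x \in B) = (x \in [set x | B (a * x)]) by [].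
by apply/idP/idP; rewrite !inE.
Qed.

(** Substituting [y = Num.sqrt q * x] turns the kernel of precision [q] into a multiple of a
    unit-variance density, to which [normal_pdf_mlr] applies. Here [e] is what completing the square
    leaves over. *)
Lemma gauss_kernel_mlr (S : set R) (q m e C c k : R)
    (f := fun x : R => (C * expR (- (q * (x - m) ^+ 2 + e) / 2))%:E) : 0 < q ->
      0 <= C ->
  measurable S -> (forall y, S y -> S (- y)) ->
  0 <= c -> [set y | c <= y ^+ 2] `<=` S ->
  1 <= k -> (N S <= k%:E * N [set y | (c <= y ^+ 2)%R])%E ->
  (\int[leb]_(x in [set x | S (Num.sqrt q * x)%R]) f x <=
   k%:E * \int[leb]_(x in [set x | (c <= q * x ^+ 2)%R]) f x)%E.
Proof.
move=> q0 C0 mS SN c0 AS k1 NSA.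
have sq0 : 0 < Num.sqrt q by rewrite sqrtr_gt0.
pose C' := C * expR (- e / 2) / normal_peak (1 : R).
have p0 : 0 < normal_peak (1 : R) by rewrite normal_peak_gt0 ?oner_neq0.
have C'0 : 0 <= C' by rewrite divr_ge0 ?mulr_ge0 ?expR_ge0 ?normal_peak_ge0.
have fE x : f x = (C'%:E * (phi (Num.sqrt q * x - Num.sqrt q * m))%:E)%E.
  rewrite -EFinM normal_pdf01E /f /C' -mulrBr exprMn sqr_sqrtr ?(ltW q0)//.
  rewrite [in RHS]mulrA divfK ?gt_eqF// -mulrA -expRD.
  by congr (_ * expR _)%:E; field.
have scaleE D : measurable D ->
    ((Num.sqrt q)%:E * \int[leb]_(x in [set x | D (Num.sqrt q * x)%R]) f x =
     C'%:E * \int[leb]_(y in D) (phi (y - Num.sqrt q * m))%:E)%E.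
  move=> mD; rewrite [in RHS](@ge0_integral_scale (Num.sqrt q))//; last 3 first.
  - by rewrite gt_eqF.
  - exact: measurable_normal_pdf_shift.
  - by move=> x; rewrite lee_fin normal_pdf_ge0.
  rewrite muleCA gtr0_norm//; congr (_ * _)%E.
  rewrite -ge0_integralZl//.
  - by apply: eq_integral => x _; rewrite fE.
  - exact: measurable_scale.
  - apply: measurable_funTS.
    apply: (measurableT_comp (measurable_normal_pdf_shift (Num.sqrt q * m))).
    exact: measurable_funM.
  - by move=> x _; rewrite lee_fin normal_pdf_ge0.
rewrite -(@lee_pmul2l _ (Num.sqrt q)%:E) ?lte_fin// muleCA.
have -> : [set x | c <= q * x ^+ 2] =
    [set x | [set y | c <= y ^+ 2] (Num.sqrt q * x)].
  by apply/seteqP; split => x /=; rewrite exprMn sqr_sqrtr// ltW.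
rewrite !scaleE//; last exact: measurable_sqr_ge.
rewrite [leRHS]muleCA; apply: lee_wpmul2l; first by rewrite lee_fin.
exact: normal_pdf_mlr.
Qed.

Lemma integral_gauss_kernel (s : R) (B : set R) : 0 < s -> measurable B ->
  (\int[leb]_(x in B) (expR (- (x ^+ 2 / s) / 2))%:E =
   (Num.sqrt s / normal_peak 1)%:E * N [set y | B (Num.sqrt s * y)%R])%E.
Proof.
move=> s0 mB; have ss0 : 0 < Num.sqrt s by rewrite sqrtr_gt0.
have p0 : 0 < normal_peak (1 : R) by rewrite normal_peak_gt0 ?oner_neq0.
rewrite (@ge0_integral_scale (Num.sqrt s))//; last 2 first.
- by rewrite gt_eqF.
- apply/measurable_EFinP; apply: measurableT_comp => //=.
  apply: measurable_funM => //; apply: measurableT_comp => //.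
  by apply: measurable_funM => //; exact: measurable_funX.
rewrite gtr0_norm// EFinM -muleA; congr (_ * _)%E.
rewrite /normal_prob -ge0_integralZl//; last 4 first.
- exact: measurable_scale.
- apply/measurable_EFinP/measurable_funTS; exact: measurable_normal_pdf.
- by move=> x _; rewrite lee_fin normal_pdf_ge0.
- by rewrite lee_fin invr_ge0 ltW.
apply: eq_integral => x _; rewrite -EFinM normal_pdf01E; congr EFin.
rewrite exprMn sqr_sqrtr ?(ltW s0)// mulKf ?gt_eqF//.
by rewrite [s * _]mulrC mulfK ?gt_eqF.
Qed.

End scaling.

(** * Positive definite matrices *)

Section quadratic_forms.
Context {R : realType}.

Definition qform n (A : 'M[R]_n) (v : 'cV[R]_n) : R := (v^T *m A *m v) 0 0.

Lemma posdefmx_unit n (S : 'M[R]_n) : posdefmx S -> S \in unitmx.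
Proof.
move=> [_ S0]; rewrite unitmxE unitfE; apply/negP => /det0P[v v0 vS].
have vT0 : v^T != 0.
  by apply: contra_neq v0 => vT0; rewrite -(trmxK v) vT0 trmx0.
by have := S0 _ vT0; rewrite trmxK vS mul0mx mxE ltxx.
Qed.

(** The form of the inverse at [v] is the form of [S] at [invmx S *m v], which is nonzero when [v]
    is. *)
Lemma posdefmx_inv n (S : 'M[R]_n) : posdefmx S -> posdefmx (invmx S).
Proof.
move=> Spd; have Su := posdefmx_unit Spd; have [ST S0] := Spd.
have AT : (invmx S)^T = invmx S by rewrite trmx_inv ST.
split=> // v v0; have -> : v^T *m invmx S *m v =
    (invmx S *m v)^T *m S *m (invmx S *m v).
  by rewrite trmx_mul AT -!mulmxA (mulKVmx Su).
apply: S0; apply: contra_neq v0 => Av0.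
by rewrite -(mulKVmx Su v) Av0 mulmx0.
Qed.

Lemma qform_delta n (A : 'M[R]_n) i : qform A (delta_mx i 0) = A i i.
Proof.
by rewrite /qform trmx_delta -rowE -colE !mxE.
Qed.

Lemma posdefmx_diag n (S : 'M[R]_n) i : posdefmx S -> 0 < S i i.
Proof.
move=> [_ S0]; rewrite -qform_delta; apply: S0; apply/negP => /eqP/matrixP.
by move=> /(_ i 0); rewrite !mxE !eqxx => /eqP; rewrite oner_eq0.
Qed.

Lemma qformDZ n (A : 'M[R]_n) (b u : 'cV[R]_n) (x : R) : A^T = A ->
  qform A (x *: b + u) =
  x ^+ 2 * qform A b + 2 * x * (b^T *m A *m u) 0 0 + qform A u.
Proof.
move=> AT; rewrite /qform.
have -> : (x *: b + u)^T *m A *m (x *: b + u) =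
    x ^+ 2 *: (b^T *m A *m b) + x *: (b^T *m A *m u) + x *: (u^T *m A *m b)
    + u^T *m A *m u.
  have -> : (x *: b + u)^T = x *: b^T + u^T.
    by apply/matrixP => j k; rewrite !mxE.
  rewrite !mulmxDl !mulmxDr -!scalemxAl.
  by rewrite -!scalemxAr scalerA -expr2 !addrA.
have -> : u^T *m A *m b = b^T *m A *m u.
  have <- : (b^T *m A *m u)^T = u^T *m A *m b.
    by rewrite !trmx_mul trmxK AT mulmxA.
  by apply/matrixP => j k; rewrite !ord1 mxE.
by rewrite !mxE; ring.
Qed.

Lemma mulmx_row'col' n m (A : 'M[R]_(m, n.+1)) (v : 'cV[R]_n.+1) i k :
  (A *m v) k 0 = A k i * v i 0 + (row k (col' i A) *m row' i v) 0 0.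
Proof.
rewrite !mxE (bigD1_ord i)//=; congr (_ + _).
by apply: eq_bigr => j _; rewrite !mxE.
Qed.

(** The form of the minor is that of [S] on vectors with [i]-th coordinate 0; [w] is [v] padded in
    this way. *)
Lemma posdefmx_minor n (S : 'M[R]_n.+1) i :
  posdefmx S -> posdefmx (row' i (col' i S)).
Proof.
move=> [ST S0]; split.
  by rewrite -[in RHS]ST; apply/matrixP => j k; rewrite !mxE.
move=> v v0; pose w : 'cV[R]_n.+1 := \col_j oapp (v^~ 0) 0 (unlift i j).
have wi : w i 0 = 0 by rewrite mxE unlift_none.
have wl : row' i w = v.
  by apply/matrixP => j k; rewrite !mxE liftK/= ord1.
have := S0 w; suff -> : w^T *m S *m w = v^T *m row' i (col' i S) *m v.
  apply; apply: contra_neq v0 => w0; rewrite -wl w0.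
  by apply/matrixP => j k; rewrite !mxE.
apply/matrixP => j k; rewrite !ord1 (mulmx_row'col' _ _ i) wi mulr0 add0r wl.
congr ((_ *m v) _ _); apply/matrixP => l h;
  rewrite !mxE (bigD1_ord i)//= mxE wi mul0r add0r.
by apply: eq_bigr => g _; rewrite !mxE liftK/= ord1.
Qed.

(** A Schur complement, read off column [i] of [S *m invmx S = 1]. The rows other than [i] express
    the off-diagonal part [a] as [- q] times [invmx M *m s]; row [i] then gives
    [q * (S i i - r) = 1] with [r] the form of [invmx M] at [s]. *)
Lemma shift_weight_invmx n (S : 'M[R]_n.+1) i : posdefmx S ->
  shift_weight S i = (invmx S i i * S i i)^-1.
Proof.
move=> Spd; have Su := posdefmx_unit Spd; have S0 := posdefmx_diag i Spd.
have q0 := posdefmx_diag i (posdefmx_inv Spd); have [ST _] := Spd.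
rewrite /shift_weight /sq_mult_corr.
set M := row' i (col' i S); set s := row' i (col i S).
have Mu : M \in unitmx by apply/posdefmx_unit/posdefmx_minor.
set q := invmx S i i in q0 *; pose a := row' i (col i (invmx S)).
have Sa k : S k i * q + (row k (col' i S) *m a) 0 0 = (k == i)%:R.
  have /matrixP/(_ k i) := mulmxV Su; rewrite [RHS]mxE => <-.
  have -> : q = col i (invmx S) i 0 by rewrite mxE.
  rewrite -mulmx_row'col' !mxE; apply: eq_bigr => j _; by rewrite mxE.
have aE : a = - (q *: (invmx M *m s)).
  suff Ma : M *m a = - (q *: s).
    by rewrite -(mulKmx Mu a) Ma mulmxN -scalemxAr.
  apply/matrixP => j k; rewrite ord1; have := Sa (lift i j).
  rewrite [_ == i]eq_sym (negbTE (neq_lift _ _)) addrC => /eqP.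
  rewrite addr_eq0 => /eqP Mja.
  transitivity ((row (lift i j) (col' i S) *m a) 0 0).
    by rewrite !mxE; apply: eq_bigr => h _; rewrite !mxE.
  by rewrite Mja !mxE mulrC.
have := Sa i; rewrite eqxx aE.
have -> : row i (col' i S) = s^T.
  by apply/matrixP => j k; rewrite !mxE -[in LHS]ST mxE.
have -> : (s^T *m - (q *: (invmx M *m s))) 0 0 = - (q * (s^T *m invmx M *m s) 0
  0).
  by rewrite mulmxN -scalemxAr mulmxA mxE [in LHS]mxE.
move: (_ 0 0) => r qE; have -> : r = S i i - q^-1.
  apply: (mulfI (lt0r_neq0 q0)); rewrite mulrBr divff ?gt_eqF//.
  by rewrite mulr1n in qE; lra.
by field; rewrite !gt_eqF.
Qed.

End quadratic_forms.

(** * The multivariate normal density and law *)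

Section gaussian_vector.
Context {R : realType} {n : nat}.
Variables (Sigma : 'M[R]_n.+1) (mu : 'cV[R]_n.+1).
Hypothesis Spd : posdefmx Sigma.
Local Notation leb := (@lebesgue_measure R).
Local Notation vec := (n.+1.-tuple (measurableTypeR R)).
Local Notation N := (normal_prob (0 : R) 1).
Local Notation sf := (@chi2_sf R 1).
Local Notation A := (invmx Sigma).
Local Notation pdf := (mvnormal_pdf mu Sigma).

(** The inverse weight is [A i i * Sigma i i], and its second factor cancels the variance in the
    squared z-statistic. *)
Lemma shifted_pvalueE (x : vec) i :
  shifted_pvalue Sigma x i = sf (A i i * tnth x i ^+ 2).
Proof.
have S0 := posdefmx_diag i Spd.
rewrite /shifted_pvalue /pvalue chi2_isf1K ?sqr_ge0// shift_weight_invmx//.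
rewrite invrK /zstat expr_div_n sqr_sqrtr ?(ltW S0)//.
by congr (sf _); field; rewrite gt_eqF.
Qed.

Let K0 : R := (Num.sqrt ((pi *+ 2) ^+ n.+1 * \det Sigma))^-1.

Let K0_ge0 : 0 <= K0. Proof. by rewrite invr_ge0 sqrtr_ge0. Qed.

Lemma mvnormal_pdfE (t : vec) :
  pdf t = K0 * expR (- qform A (\col_i tnth t i - mu) / 2).
Proof. by []. Qed.

Lemma mvnormal_pdf_ge0 (t : vec) : 0 <= pdf t.
Proof. by rewrite mvnormal_pdfE mulr_ge0 ?expR_ge0. Qed.

Lemma measurable_mvnormal_pdf : measurable_fun setT (EFin \o pdf).
Proof.
apply/measurable_EFinP; apply: measurable_funM => //;
  apply: measurableT_comp => //.
apply: measurable_funM => //; apply: measurableT_comp => //=.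
have vE j : measurable_fun setT (fun t : vec => (\col_i tnth t i - mu) j 0).
  have -> : (fun t : vec => (\col_i tnth t i - mu) j 0) = fun t => tnth t j -
    mu j 0.
    by apply/funext => t; rewrite !mxE.
  by apply: measurable_funB => //; exact: measurable_tnth.
have -> : (fun t : vec => ((\col_i tnth t i - mu)^T *m A *m (\col_i tnth t i -
  mu)) 0 0)
  = fun t => \sum_k (\sum_j (\col_i tnth t i - mu) j 0 * A j k) *
      (\col_i tnth t i - mu) k 0.
  apply/funext => t; rewrite mxE; apply: eq_bigr => k _; congr (_ * _).
  by rewrite mxE; apply: eq_bigr => j _; congr (_ * _); rewrite mxE.
apply: measurable_sum => k; apply: measurable_funM => //.
by apply: measurable_sum => j; apply: measurable_funM.
Qed.

(** Completing the square in coordinate [i]: given the others it is normal with precision [A i i],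
    which is constant, and mean [m], which may depend on [t]. *)
Lemma mvnormal_pdf_ins i (t : n.-tuple (measurableTypeR R)) : mu i 0 = 0 ->
  exists C m e, 0 <= C /\ forall x,
    pdf (tuple_ins i x t) = C * expR (- (A i i * (x - m) ^+ 2 + e) / 2).
Proof.
move=> mui; have Apd := posdefmx_inv Spd; have [AT _] := Apd.
have q0 : A i i != 0 by rewrite gt_eqF// posdefmx_diag.
pose u : 'cV[R]_n.+1 := \col_j tnth (tuple_ins i (0 : R) t) j - mu.
pose l : R := ((delta_mx i (0 : 'I_1))^T *m A *m u) 0 0.
(* The centred vector is [x *: delta_mx i 0 + u], so the exponent involves
   [A i i * x ^+ 2 + 2 * l * x + qform A u]. *)
exists K0, (- l / A i i), (qform A u - l ^+ 2 / A i i); split=> // x.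
rewrite mvnormal_pdfE; have -> : \col_j tnth (tuple_ins i x t) j - mu =
    x *: delta_mx i 0 + u.
  apply/matrixP => j k; rewrite !ord1 !mxE; case: (unliftP i j) => [h|] ->.
    by rewrite !tnth_ins_lift eq_sym (negbTE (neq_lift _ _)) mulr0 add0r.
  by rewrite !tnth_ins !eqxx mui mulr1 !subr0 addr0.
rewrite qformDZ// qform_delta -/l.
suff -> : x ^+ 2 * A i i + 2 * x * l + qform A u =
    A i i * (x - - l / A i i) ^+ 2 + (qform A u - l ^+ 2 / A i i) by [].
move: (A i i) (qform A u) q0 => q e q0; field.
exact: q0.
Qed.

(** The slope in the linear regression of the [j]-th other coordinate on coordinate [i]. *)
Definition regr_slope (i : 'I_n.+1) (j : 'I_n) : R := Sigma (lift i j) i /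
  Sigma i i.

(** The regression residuals of the other coordinates are uncorrelated with coordinate [i], so the
    density factors once [t] is replaced by its residuals. *)
Lemma mvnormal_pdf_ins_shift i x (t : n.-tuple (measurableTypeR R)) :
  mu i 0 = 0 ->
  pdf (tuple_ins i x t) = expR (- (x ^+ 2 / Sigma i i) / 2) *
    pdf (tuple_ins i (0 : R) (tuple_shift (fun j => - (x * regr_slope i j)%R)
      t)).
Proof.
move=> mui; have Su := posdefmx_unit Spd; have s0 := posdefmx_diag i Spd.
have [AT _] := posdefmx_inv Spd.
set t' := tuple_shift _ t.
pose u : 'cV[R]_n.+1 := \col_j tnth (tuple_ins i (0 : R) t') j - mu.
(* b is A-orthogonal to every vector whose i-th coordinate is 0, such as u. *)
pose b : 'cV[R]_n.+1 := (Sigma i i)^-1 *: col i Sigma.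
have bA : b^T *m A = (Sigma i i)^-1 *: (delta_mx i 0)^T.
  rewrite -[b^T *m A]trmxK trmx_mul trmxK AT /b colE -scalemxAr mulmxA.
  rewrite mulVmx// mul1mx.
  by apply/matrixP => j k; rewrite !mxE.
rewrite !mvnormal_pdfE mulrCA -expRD.
have -> : \col_j tnth (tuple_ins i x t) j - mu = x *: b + u.
  apply/matrixP => j k; rewrite !ord1 !mxE; case: (unliftP i j) => [h|] ->.
    rewrite !tnth_ins_lift tnth_mktuple /regr_slope.
    by field; rewrite gt_eqF.
  by rewrite !tnth_ins mui mulVf ?gt_eqF// mulr1 !subr0 addr0.
have iu (v : 'cV[R]_n.+1) : (b^T *m A *m v) 0 0 = v i 0 / Sigma i i.
  by rewrite bA -scalemxAl mxE trmx_delta -rowE mxE mulrC.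
have ui : u i 0 = 0 by rewrite !mxE tnth_ins mui subrr.
have qb : qform A b = (Sigma i i)^-1.
  by rewrite /qform iu !mxE mulVf ?gt_eqF// div1r.
rewrite qformDZ// iu ui qb; congr (_ * _); congr expR.
move: (qform A u) (Sigma i i) s0 => q s s0; field.
by rewrite gt_eqF.
Qed.

End gaussian_vector.

(** * Conditional comparison and one-dimensional marginals *)

Section gaussian_law.
Context {R : realType} {n : nat}.
Variables (Sigma : 'M[R]_n.+1) (mu : 'cV[R]_n.+1).
Hypothesis Spd : posdefmx Sigma.
Local Notation leb := (@lebesgue_measure R).
Local Notation vec := (n.+1.-tuple (measurableTypeR R)).
Local Notation N := (normal_prob (0 : R) 1).
Local Notation A := (invmx Sigma).
Local Notation pdf := (mvnormal_pdf mu Sigma).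
Context {disp : measure_display} {T : measurableType disp}.
Variables (P : probability T R) (X : {RV P >-> vec}).
Hypothesis hX : is_mvnormal X mu Sigma.

Let pdfB (B : set vec) := ((EFin \o pdf) \_ B)%E.

Let pdfB_ge0 B t : (0 <= pdfB B t)%E.
Proof. by apply: erestrict_ge0 => s _; rewrite lee_fin mvnormal_pdf_ge0. Qed.

Let measurable_pdfB B : measurable B -> measurable_fun setT (pdfB B).
Proof.
move=> mB; apply/(measurable_restrictT _ _).1 => //.
by apply: measurable_funTS; exact: measurable_mvnormal_pdf.
Qed.

Lemma distribution_mvnormal_ins i B : measurable B ->
  distribution P X B =
  (\int[tuple_prod leb n]_t \int[leb]_x
     ((EFin \o pdf) \_ B) (tuple_ins i x t))%E.
Proof.
move=> mB; rewrite hX// integral_mkcond (ge0_integral_tuple_ins leb i)//.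
- exact: measurable_pdfB.
- exact: pdfB_ge0.
Qed.

Let measurable_pdfB_ins i B : measurable B ->
  measurable_fun setT (fun z : n.-tuple (measurableTypeR R) * measurableTypeR R
    =>
    pdfB B (tuple_ins i z.2 z.1)).
Proof.
by move=> mB; exact: measurableT_comp (measurable_pdfB mB)
  (measurable_tuple_ins i).
Qed.

Lemma measurable_tnth_preimage i (B : set R) : measurable B ->
  measurable [set t : vec | B (tnth t i)].
Proof.
move=> mB; rewrite -[X in measurable X]setTI.
exact: (@measurable_tnth _ (measurableTypeR R) _ i).
Qed.

(* Conditionally on the other coordinates X_i is normal with variance
   1 / A i i, which is what normalises the likelihood ratio bound. *)
Lemma distribution_mvnormal_mlr i (S : set R) (E : set vec) (c k : R) :
  mu i 0 = 0 -> measurable S -> (forall y, S y -> S (- y)) ->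
  0 <= c -> [set y | c <= y ^+ 2] `<=` S ->
  1 <= k -> (N S <= k%:E * N [set y | (c <= y ^+ 2)%R])%E ->
  measurable E -> (forall x t, E (tuple_ins i x t) <-> E (tuple_ins i (0 : R)
    t)) ->
  (distribution P X ([set t | S (Num.sqrt (A i i) * tnth t i)%R] `&` E) <=
   k%:E *
   distribution P X ([set t | (c <= A i i * tnth t i ^+ 2)%R] `&` E))%E.
Proof.
move=> mui mS SN c0 AS k1 NSA mE Ei.
have q0 := posdefmx_diag i (posdefmx_inv Spd).
have k0 : 0 <= k := le_trans ler01 k1.
have mSE : measurable ([set t : vec | S (Num.sqrt (A i i) * tnth t i)%R] `&` E).
  apply: measurableI => //.
  exact: (@measurable_tnth_preimage i [set x | S (Num.sqrt (A i i) * x)]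
    (measurable_scale _ mS)).
have mcE : measurable ([set t : vec | c <= A i i * tnth t i ^+ 2] `&` E).
  apply: measurableI => //.
  apply: (@measurable_tnth_preimage i [set x | c <= A i i * x ^+ 2]).
  have := measurable_scale (Num.sqrt (A i i)) (measurable_sqr_ge c).
  by congr measurable; apply/seteqP; split => x /=;
    rewrite exprMn sqr_sqrtr// ltW.
rewrite !(distribution_mvnormal_ins i)//.
rewrite -(@ge0_integralZl_EFin _ _ _ _ _ measurableT)//; last 2 first.
- by move=> t _; apply: integral_ge0 => x _; exact: pdfB_ge0.
- exact: (measurable_fun_fubini_tonelli_F _ (measurable_pdfB_ins i mcE)).
apply: ge0_le_integral => //.
- by move=> t _; apply: integral_ge0 => x _; exact: pdfB_ge0.
- exact: (measurable_fun_fubini_tonelli_F _ (measurable_pdfB_ins i mSE)).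
- apply: emeasurable_funM => //.
  exact: (measurable_fun_fubini_tonelli_F _ (measurable_pdfB_ins i mcE)).
(* With the other coordinates fixed, [E] either fails for every [x], making both sides 0, or holds
   for every [x] and drops out. *)
move=> t _.
have [Et|nEt] := pselect (E (tuple_ins i (0 : R) t)); last first.
  have pdfB0 (D : set vec) x : pdfB (D `&` E) (tuple_ins i x t) = 0%E.
    by rewrite /pdfB patchE memNset// => -[_ /Ei].
  by rewrite !integral0_eq ?mule0// => x _; exact: pdfB0.
have [C [m [e [C0 pdfE]]]] := mvnormal_pdf_ins Spd t mui.
have := gauss_kernel_mlr m e q0 C0 mS SN c0 AS k1 NSA.
rewrite [X in (X <= _)%E]integral_mkcond [X in (_ * X)%E]integral_mkcond.
congr (_ <= _ * _)%E; apply: eq_integral => x _; rewrite /pdfB /patch.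
  rewrite (_ : (tuple_ins i x t \in _) = (x \in [set x | S (Num.sqrt (A i i) *
    x)])).
    by case: ifP => //= _; rewrite pdfE.
  by apply/idP/idP; rewrite !inE /= tnth_ins; [case|split=> //; exact/Ei].
rewrite (_ : (tuple_ins i x t \in _) = (x \in [set x | c <= A i i * x ^+ 2])).
  by case: ifP => //= _; rewrite pdfE.
by apply/idP/idP; rewrite !inE /= tnth_ins; [case|split=> //; exact/Ei].
Qed.

(** After the regression shift, translation invariance makes the integral over the other coordinates
    a constant [K], leaving a centred kernel of variance [Sigma i i] in [x]. *)
Lemma distribution_mvnormal_marginal i (B : set R) :
  mu i 0 = 0 -> measurable B ->
  distribution P X [set t | B (tnth t i)] =
  N [set y | B (Num.sqrt (Sigma i i) * y)].
Proof.
move=> mui mB; have s0 := posdefmx_diag i Spd.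
pose g t := (pdf (tuple_ins i (0 : R) t))%:E.
have g0 t : (0 <= g t)%E by rewrite lee_fin mvnormal_pdf_ge0.
have mg : measurable_fun setT g.
  apply: (measurableT_comp (measurable_mvnormal_pdf Sigma mu)).
  apply: (measurableT_comp (measurable_tuple_ins i) (g := fun t => (t, (0 :
    R)))).
  exact: measurable_fun_pair.
pose K := (\int[tuple_prod leb n]_t g t)%E.
have K0 : (0 <= K)%E by apply: integral_ge0.
have mexp : measurable_fun setT
    (fun x : R => (expR (- (x ^+ 2 / Sigma i i) / 2))%:E).
  apply/measurable_EFinP; apply: measurableT_comp => //=.
  apply: measurable_funM => //; apply: measurableT_comp => //.
  by apply: measurable_funM => //; exact: measurable_funX.
have distE D : measurable D -> distribution P X [set t | D (tnth t i)] =
    (K * (Num.sqrt (Sigma i i) / normal_peak 1)%:E *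
     N [set y | D (Num.sqrt (Sigma i i) * y)%R])%E.
  move=> mD; have mDi := measurable_tnth_preimage i mD.
  rewrite (distribution_mvnormal_ins i)//.
  have := fubini_tonelli _ (measurable_pdfB_ins i mDi) (fun z => pdfB_ge0 _ _).
  move=> /= ->.
  rewrite -muleA -integral_gauss_kernel//.
  have eD x : D x -> (0 <= (expR (- (x ^+ 2 / Sigma i i) / 2))%:E)%E.
    by rewrite lee_fin expR_ge0.
  rewrite -(ge0_integralZl leb mD (measurable_funTS mexp) eD K0).
  rewrite [RHS]integral_mkcond; apply: eq_integral => x _.
  rewrite [RHS]patchE; case: ifPn => xD; last first.
    apply: integral0_eq => t _; rewrite /pdfB /= patchE memNset//= tnth_ins.
    by move: xD; rewrite notin_setE.
  rewrite muleC /K -(ge0_integral_tuple_shift (fun j => - (x * regr_slope Sigma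
    i j)))//.
  rewrite -ge0_integralZl//; last first.
    exact: (measurableT_comp mg (measurable_tuple_shift _)).
  apply: eq_integral => t _; rewrite /pdfB /= patchE mem_set/= ?tnth_ins;
    last first.
    by move: xD; rewrite inE.
  by rewrite -EFinM mvnormal_pdf_ins_shift.
have NT : N [set y | [set: R] (Num.sqrt (Sigma i i) * y)] = 1%E.
  exact: probability_setT.
(* The normalising constants are recovered from the total mass. *)
have := distE _ measurableT; rewrite NT mule1.
rewrite [LHS](_ : _ = 1%E); last exact: probability_setT.
by move=> K1; rewrite distE// -K1 mul1e.
Qed.

End gaussian_law.

(** * Bounding the false discovery rate *)

(** Finitely many Boolean tests have finitely many joint outcomes, so the event is a finite union of
    finite intersections. *)
Lemma measurable_ffun_bool {disp : measure_display} {T : measurableType disp}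
    {I : finType} (b : I -> T -> bool) (F : {ffun I -> bool} -> Prop) :
  (forall i, measurable [set x | b i x]) ->
  measurable [set x | F [ffun i => b i x]].
Proof.
move=> mb.
have -> : [set x | F [ffun i => b i x]] =
    \bigcup_(g in [set g | F g]) \bigcap_(i in [set: I]) [set x | b i x = g i].
  apply/seteqP; split => x /=.
    by move=> Fb; exists [ffun i => b i x] => // i _; rewrite /= ffunE.
  by move=> [g Fg gb]; rewrite (_ : finfun _ = g)//; apply/ffunP => i;
    rewrite ffunE gb.
apply: fin_bigcup_measurable; first exact: finite_finset.
move=> g _; apply: fin_bigcap_measurable; first exact: finite_finset.
move=> i _; case: (g i); first exact: mb.
have := measurableC (mb i); congr measurable; apply/seteqP; split => x /=.
  by move/negP/negbTE.
by move=> ->.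
Qed.

(** The integral is a supremum over simple functions lying below the integrand. This bounds the
    false discovery proportion without a measurability proof for it. *)
Lemma le_integral_nonmeasurable {disp : measure_display} {T : measurableType
  disp}
    {R : realType} (m : {measure set T -> \bar R}) (f g : T -> \bar R) :
  (forall x, 0 <= f x)%E -> (forall x, f x <= g x)%E ->
  (\int[m]_x f x <= \int[m]_x g x)%E.
Proof.
move=> f0 fg; rewrite !ge0_integralTE//; last first.
  by move=> x; exact: le_trans (fg x).
apply: le_ereal_sup => _ [h hf <-]; exists h => // x.
exact: le_trans (hf x) (fg x).
Qed.

Lemma loo_index_measurable {R : realType} {d : nat} {disp : measure_display}
    {T : measurableType disp} (c : nat -> R) (p : T -> 'I_d -> R) i k :
  (forall j a, measurable [set x | p x j <= a]) ->
  measurable [set x | loo_index c (p x) i = k].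
Proof.
move=> mp; pose F (g : {ffun 'I_d * 'I_d -> bool}) :=
  \max_(k < d | (k < #|[set j | (j == i) || g (j, k)]%SET|)%N) k.+1.
have -> : [set x | loo_index c (p x) i = k] =
    [set x | F [ffun jk : 'I_d * 'I_d => p x jk.1 <= c jk.2.+1] = k].
  apply/seteqP; split => x /= <-; [symmetry|]; apply: eq_bigl => l;
    congr (_ < _)%N; apply: eq_card => j; by rewrite !inE ffunE.
exact: (measurable_ffun_bool (fun g => F g = k)).
Qed.

(** A rejected null contributes the inverse of the number of rejections, at most the inverse of its
    [loo_index], which is the only nonzero term of its inner sum. *)
Lemma fdp_le {R : realType} {d : nat} (c : nat -> R) (p : 'I_d -> R)
    (nulls : {set 'I_d}) :
  {homo c : k l / (k <= l)%N >-> k <= l} ->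
  #|stepup_rejections c p :&: nulls|%:R /
    (maxn #|stepup_rejections c p| 1)%:R <=
  \sum_(i in nulls) \sum_(k < d)
    k.+1%:R^-1 * ((p i <= c k.+1) && (loo_index c p i == k.+1))%:R :> R.
Proof.
move=> c_nd; set S := stepup_rejections c p;
  rewrite -sum1_card natr_sum mulr_suml big_mkcond [leRHS]big_mkcond/=.
apply: ler_sum => i _; rewrite finset.in_setI.
have sum0 : 0 <= \sum_(k < d)
    k.+1%:R^-1 * ((p i <= c k.+1) && (loo_index c p i == k.+1))%:R :> R.
  by apply: sumr_ge0 => k _; rewrite mulr_ge0 ?invr_ge0.
case: ifPn => [/andP[iS ->]|_]; last by case: ifP.
have [pc /andP[loo0 looS]] := stepup_rejections_loo c_nd iS.
have lood := loo_index_le c p i.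
have lt_loo : ((loo_index c p i).-1 < d)%N by rewrite prednK.
rewrite (bigD1 (Ordinal lt_loo))//= prednK// pc eqxx mulr1 mul1r.
rewrite -[leLHS]addr0 lerD//.
  have max0 : (0 < maxn #|S| 1)%N by rewrite leq_max orbT.
  by rewrite lef_pV2 ?posrE ?ltr0n// ler_nat (leq_trans looS)// leq_maxl.
by apply: sumr_ge0 => k _; rewrite mulr_ge0 ?invr_ge0.
Qed.



(** The level sets of [f] are disjoint, so they cut [C] into disjoint pieces. *)
Lemma sum_measure_level_le {disp : measure_display} {T : measurableType disp}
    {R : realType} (m : {measure set T -> \bar R}) (C : set T) (f : T ->
      nat) d :
  measurable C -> (forall k, measurable [set x | f x = k]) ->
  (\sum_(k < d) m (C `&` [set x | f x = k.+1]) <= m C)%E.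
Proof.
move=> mC mf; have mCf k : measurable (C `&` [set x | f x = k]).
  exact: measurableI.
rewrite -(@measure_bigsetU_ord _ _ _ m d xpredT (fun k : 'I_d => C `&` [set x |
  f x = k.+1])).
- apply: le_measure; rewrite ?inE//.
    by apply: bigsetU_measurable => k _; exact: mCf.
  by move=> x; rewrite -bigcup_seq => -[k _ []].
- by move=> k; exact: mCf.
- apply/trivIsetP => k l _ _ kl; apply/seteqP;
  split => // x [[_ /= fk] [_ /= fl]].
  by case/negP: kl; rewrite -val_eqE/= -eqSS -fk -fl.
Qed.

(** * Shifted p-values of a Gaussian vector *)

Section stepup_gaussian.
Context {R : realType} {n : nat}.
Variables (Sigma : 'M[R]_n.+1) (mu : 'cV[R]_n.+1).
Hypothesis Spd : posdefmx Sigma.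
Local Notation vec := (n.+1.-tuple (measurableTypeR R)).
Local Notation N := (normal_prob (0 : R) 1).
Local Notation sf := (@chi2_sf R 1).
Local Notation q i := (invmx Sigma i i).

Let q_gt0 i : 0 < q i.
Proof. exact: posdefmx_diag (posdefmx_inv Spd). Qed.

Let sqrtqM i (y : R) : (Num.sqrt (q i) * y) ^+ 2 = q i * y ^+ 2.
Proof. by rewrite exprMn sqr_sqrtr// ltW. Qed.

Lemma measurable_shifted_pvalue_le i (a : R) :
  measurable [set x : vec | shifted_pvalue Sigma x i <= a].
Proof.
under eq_set do rewrite shifted_pvalueE// -sqrtqM.
exact: (@measurable_tnth_preimage R n i _
  (measurable_scale _ (measurable_chi2_sf1_sqr_le a))).
Qed.

Lemma measurable_scaled_sqr_ge i (c : R) :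
  measurable [set x : R | c <= q i * x ^+ 2].
Proof.
under eq_set do rewrite -sqrtqM.
exact: (measurable_scale _ (measurable_sqr_ge c)).
Qed.

Lemma measurable_loo_index c i k :
  measurable [set x : vec | loo_index c (shifted_pvalue Sigma x) i = k].
Proof. by apply: loo_index_measurable => j a;
  exact: measurable_shifted_pvalue_le. Qed.

(** The other shifted p-values do not involve coordinate [i], so the level events of [loo_index] are
    fixed by the conditioning. *)
Lemma loo_index_ins c i (x : R) t :
  loo_index c (shifted_pvalue Sigma (tuple_ins i x t)) i =
  loo_index c (shifted_pvalue Sigma (tuple_ins i (0 : R) t)) i.
Proof.
apply: eq_loo_index => j; rewrite eq_sym => /unlift_some[l -> _].
by rewrite /shifted_pvalue /pvalue /zstat !tnth_ins_lift.
Qed.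

Context {disp : measure_display} {T : measurableType disp}.
Variables (P : probability T R) (X : {RV P >-> vec}).
Hypothesis hX : is_mvnormal X mu Sigma.

(** The region [S] has null probability at most [k * sf c] by superuniformity, and it contains
    [c <= y ^+ 2] because [sf] is nonincreasing and [1 <= k]. *)
Lemma distribution_shifted_pvalue_mlr i (crit : nat -> R) (c : R) k r :
  mu i 0 = 0 -> 0 <= c -> 1 <= k ->
  (distribution P X ([set x | (shifted_pvalue Sigma x i <= k * sf c)%R] `&`
     [set x | loo_index crit (shifted_pvalue Sigma x) i = r]) <=
   k%:E * distribution P X ([set x | (c <= q i * tnth x i ^+ 2)%R] `&`
     [set x | loo_index crit (shifted_pvalue Sigma x) i = r]))%E.
Proof.
move=> mui c0 k1; pose S := [set y : R | sf (y ^+ 2) <= k * sf c].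
have k0 : 0 <= k := le_trans ler01 k1.
have NS : (N S <= (k * sf c)%:E)%E.
  by apply: chi2_sf1_superuniform; rewrite mulr_ge0 ?chi2_sf1_ge0.
have -> : [set x : vec | shifted_pvalue Sigma x i <= k * sf c] =
    [set x | S (Num.sqrt (q i) * tnth x i)].
  by apply: eq_set => x; rewrite /S /mkset shifted_pvalueE// sqrtqM.
apply: (distribution_mvnormal_mlr Spd hX (S := S) mui _ _ c0 _ k1).
- exact: measurable_chi2_sf1_sqr_le.
- by move=> y; rewrite /S/= sqrrN.
- move=> y /= cy; rewrite /S/= (le_trans (chi2_sf1_le cy))//.
  by rewrite ler_peMl ?chi2_sf1_ge0.
- by apply: (le_trans NS); rewrite normal_prob_sqr_ge.
- exact: measurable_loo_index.
- move=> x t.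
  have eq_iff (a b : nat) : a = b -> a = r <-> b = r by move=> ->.
  exact: eq_iff (loo_index_ins crit i x t).
Qed.

(** Writing the coordinate as [Num.sqrt (Sigma i i) * y], its scaled square is [y ^+ 2] divided by
    the weight. *)
Lemma distribution_scaled_sqr_ge i (c : R) : mu i 0 = 0 ->
  distribution P X [set x | c <= q i * tnth x i ^+ 2] =
  (sf (shift_weight Sigma i * c))%:E.
Proof.
move=> mui; have s0 := posdefmx_diag i Spd.
rewrite (distribution_mvnormal_marginal Spd hX mui (measurable_scaled_sqr_ge i
  c)).
rewrite -normal_prob_sqr_ge; congr (normal_prob _ _ _).
apply: eq_set => y; rewrite /mkset exprMn sqr_sqrtr ?(ltW s0)//.
rewrite shift_weight_invmx// [_^-1 * _]mulrC ler_pdivrMr ?mulr_gt0//.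
by rewrite mulrA [X in _ = is_true (_ <= X)]mulrC.
Qed.

End stepup_gaussian.

(** * Control of the false discovery rate *)

Theorem theorem1 (R : realType) (d : nat) (hd : (0 < d)%N)
    (Sigma : 'M[R]_d) (hSigma : posdefmx Sigma)
    (alpha alpha1 : R) (halpha : 0 < alpha < 1) (halpha1 : 0 < alpha1 < 1)
    (hcrit : \sum_(i < d) chi2_sf 1 (shift_weight Sigma i * chi2_isf 1 alpha1)
             = alpha)
    (mu : 'cV[R]_d)
    (disp : measure_display) (T : measurableType disp) (P : probability T R)
    (X : {RV P >-> d.-tuple (measurableTypeR R)})
    (hX : is_mvnormal X mu Sigma) :
  (FDR P (true_nulls mu)
     (fun w => stepup_rejections (fun k => (k%:R * alpha1)%R)
                 (shifted_pvalue Sigma (X w)))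
   <= alpha%:E)%E.
Proof.
have [a0 a1] := andP halpha1.
have [c0 sfc] : 0 < chi2_isf 1 alpha1 /\ chi2_sf 1 (chi2_isf 1 alpha1) = alpha1.
  (* The junk value 0 is excluded, as it would give alpha = d >= 1. *)
  have [//|isf0] := chi2_isf1P alpha1; move: hcrit; rewrite isf0.
  under eq_bigr do rewrite mulr0 chi2_sf1_0.
  rewrite sumr_const card_ord => alphaE.
  have := halpha; rewrite -alphaE => /andP[_].
  by rewrite ltNge ler1n hd.
case: d hd Sigma hSigma hcrit mu X hX => // n _ Sigma Spd hcrit mu X hX.
set c := chi2_isf 1 alpha1 in c0 sfc hcrit.
pose crit k : R := k%:R * alpha1.
have crit_nd : {homo crit : k l / (k <= l)%N >-> k <= l}.
  by move=> k l kl; rewrite ler_wpM2r ?ler_nat// ltW.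
pose rej i (k : 'I_n.+1) : set (n.+1.-tuple (measurableTypeR R)) :=
  [set x | shifted_pvalue Sigma x i <= crit k.+1] `&`
  [set x | loo_index crit (shifted_pvalue Sigma x) i = k.+1].
have mrej i k : measurable (rej i k).
  apply: measurableI; first exact: measurable_shifted_pvalue_le.
  exact: measurable_loo_index.
have Prej i : mu i 0 = 0 ->
    (\sum_(k < n.+1) (k.+1%:R^-1)%:E * distribution P X (rej i k) <=
     (chi2_sf 1 (shift_weight Sigma i * c))%:E)%E.
  move=> mui; rewrite -(distribution_scaled_sqr_ge Spd hX c mui).
  have mC := measurable_tnth_preimage i (measurable_scaled_sqr_ge Spd i c).
  (* The factor [k.+1] of the likelihood ratio bound cancels the weight, leaving one region common
     to all [k], cut into disjoint levels. *)
  apply: (le_trans _ (sum_measure_level_le (distribution P X) n.+1 mC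
    (measurable_loo_index Spd crit i))).
  apply: lee_sum => k _; rewrite lee_pdivrMl ?ltr0n//.
  rewrite /rej /crit -sfc;
    apply: (distribution_shifted_pvalue_mlr Spd hX) => //.
    exact: ltW.
  by rewrite ler1n.
rewrite /FDR unlock.
pose bound w : \bar R := (\sum_(i <- enum (true_nulls mu)) \sum_(k < n.+1)
   (k.+1%:R^-1)%:E * (\1_(X @^-1` rej i k) w)%:E)%E.
(* The bound is a finite combination of indicators of measurable events, so it can be integrated
   term by term. *)
apply: (@le_trans _ _ (\int[P]_w bound w)%E).
  apply: le_integral_nonmeasurable => w.
    by rewrite lee_fin divr_ge0.
  have -> : bound w = (\sum_(i in true_nulls mu) \sum_(k < n.+1) k.+1%:R^-1 *
      ((shifted_pvalue Sigma (X w) i <= crit k.+1) &&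
       (loo_index crit (shifted_pvalue Sigma (X w)) i == k.+1))%:R)%:E.
    rewrite -sumEFin /bound big_enum; apply: eq_bigr => i _.
    rewrite -sumEFin; apply: eq_bigr => k _; rewrite -EFinM; congr (_ * _)%:E.
    rewrite indicE; congr (nat_of_bool _)%:R; apply/idP/idP.
      by rewrite inE => -[/= -> ->]; rewrite eqxx.
    by move=> /andP[pc /eqP loo]; rewrite inE.
  by rewrite lee_fin; exact: fdp_le.
have mX i k : measurable (X @^-1` rej i k).
  by rewrite -[X in measurable X]setTI; exact: measurable_funP.
have mterm i (k : 'I_n.+1) : measurable_fun setT
    (fun w => (k.+1%:R^-1)%:E * (\1_(X @^-1` rej i k) w)%:E)%E.
  apply: emeasurable_funM => //; apply/measurable_EFinP.
  exact: measurable_indic.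
have term0 i (k : 'I_n.+1) w :
    (0 <= (k.+1%:R^-1)%:E * (\1_(X @^-1` rej i k) w)%:E)%E.
  by rewrite mule_ge0// lee_fin// invr_ge0.
rewrite /bound ge0_integral_sum//; last 2 first.
- by move=> i; apply: emeasurable_sum => k; exact: mterm.
- by move=> i w _; apply: sume_ge0 => k _; exact: term0.
(* The critical equation sums over all hypotheses; the terms outside the true nulls are nonnegative
   and are dropped. *)
rewrite -hcrit -sumEFin big_enum/= [leRHS](bigID (mem (true_nulls mu)))/=.
rewrite -[leLHS]adde0; apply: leeD; last first.
  by apply: sume_ge0 => i _; rewrite lee_fin chi2_sf1_ge0.
apply: lee_sum => i; rewrite inE => /eqP mui.
rewrite ge0_integral_sum//; apply: le_trans (Prej i mui).
apply: lee_sum => k _; rewrite ge0_integralZl_EFin//.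
- by rewrite integral_indic// setIT.
- by apply/measurable_EFinP; exact: measurable_indic.
Qed.
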